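(* There is a constant $c>0$ such that for every $n\ge 4$, every rectangular layout (on the integer grid) of an $(n,n)$-ladder has area at least $c\,n^2$.
   Context: An $m$-rung ladder is a graph containing distinct vertices $L,R$ (struts) and $x_1,\dots,x_m$ (rungs) with edges $\{L,x_i\},\{x_i,R\}$ for all $i$ and, for each $1\le i<m$, a path (possibly through further vertices) from $x_i$ to $x_{i+1}$. An $(i,j)$-ladder is a graph on exactly $i+j+2$ vertices $L,R,x_1,\dots,x_i,y_1,\dots,y_j$ that is the union of an $i$-rung ladder with struts $L,R$ and rungs $x_1,\dots,x_i$ and a $j$-rung ladder with struts $x_{\lfloor i/2\rfloor}, x_{\lfloor i/2\rfloor+1}$ and rungs $y_1,\dots,y_j$. A (strong) rectangular layout of a graph is a set of axis-parallel rectangles with pairwise disjoint interiors, one per vertex, such that two rectangles' boundaries share a segment of positive length if and only if the corresponding vertices are adjacent; on the integer grid all corners are integral, and the area is that of the smallest enclosing axis-parallel bounding box. *)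

(* Defs.v *)
From mathcomp Require Import all_boot all_order all_algebra.
From mathcomp Require Import classical_sets reals.

Set Implicit Arguments.
Unset Strict Implicit.
Unset Printing Implicit Defensive.
Import Order.TTheory GRing.Theory Num.Theory.
Local Open Scope classical_set_scope.
Local Open Scope ring_scope.

Definition simple_graph (T : finType) (e : rel T) : Prop :=
  symmetric e /\ irreflexive e.

(* [e] is the edge relation of a graph containing an [m]-rung ladder with struts
   [L], [R] and rungs [x 1], ..., [x m]; other values of [x] are irrelevant.
   [p] lists the internal vertices of the path from [x k] to [x k.+1]: these are
   further vertices, i.e. neither struts nor rungs of this ladder (otherwise
   x_k, L, x_{k+1} would always be such a path). *)
Definition is_rung_ladder (T : finType) (e : rel T) (m : nat)
    (L R : T) (x : nat -> T) : Prop :=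
  let named := [:: L, R & [seq x k | k <- iota 1 m]] in
  [/\ simple_graph e,
      uniq named,
      forall k : nat, (1 <= k <= m)%N -> e L (x k) /\ e (x k) R &
      forall k : nat, (1 <= k < m)%N ->
        exists p : seq T,
          [/\ path e (x k) (rcons p (x k.+1)),
              uniq (x k :: rcons p (x k.+1)) &
              {in p, forall v, v \notin named}]].

(* The two ladders of the union are spanning subgraphs given by their edge
   relations [e1], [e2]; either may use the vertices of the other as further
   vertices. Meaningful for [2 <= i], so that [i./2] is a rung index. *)
Definition is_ij_ladder (T : finType) (e : rel T) (i j : nat) : Prop :=
  exists (L R : T) (x y : nat -> T) (e1 e2 : rel T),
    let vertices :=
      [:: L, R & [seq x k | k <- iota 1 i] ++ [seq y k | k <- iota 1 j]] in
    [/\ uniq vertices /\ (forall v : T, v \in vertices),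
        forall u v : T, e u v = e1 u v || e2 u v,
        is_rung_ladder e1 i L R x &
        is_rung_ladder e2 j (x i./2) (x i./2.+1) y].

Record rect (R : realType) := Rect {
  xlo : R; xhi : R; ylo : R; yhi : R;
  rect_x : xlo < xhi;
  rect_y : ylo < yhi }.

Section Geometry.
Variable R : realType.
Implicit Types (A B : rect R) (p q : R * R).

Definition rect_closed A : set (R * R) :=
  [set p | xlo A <= p.1 <= xhi A /\ ylo A <= p.2 <= yhi A].

Definition rect_interior A : set (R * R) :=
  [set p | xlo A < p.1 < xhi A /\ ylo A < p.2 < yhi A].

Definition rect_boundary A : set (R * R) := rect_closed A `\` rect_interior A.

Definition segment p q : set (R * R) :=
  [set r | exists2 t : R, 0 <= t <= 1 &
    r = (p.1 + t * (q.1 - p.1), p.2 + t * (q.2 - p.2))].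

Definition share_segment A B : Prop :=
  exists p q, p <> q /\
    segment p q `<=` rect_boundary A `&` rect_boundary B.

Definition on_integer_grid A : Prop :=
  [/\ xlo A \is a Num.int, xhi A \is a Num.int,
      ylo A \is a Num.int & yhi A \is a Num.int].

Definition is_rect_layout (T : finType) (e : rel T) (lay : T -> rect R) : Prop :=
  forall u v : T, u <> v ->
    rect_interior (lay u) `&` rect_interior (lay v) = set0 /\
    (share_segment (lay u) (lay v) <-> e u v).

(* The bounding box is [inf xlo, sup xhi] x [inf ylo, sup yhi]; since [T] is
   finite, the suprema and infima are maxima and minima as soon as [T] is
   inhabited. *)
Definition layout_area (T : finType) (lay : T -> rect R) : R :=
  (sup (range (fun v => xhi (lay v))) - inf (range (fun v => xlo (lay v)))) *
  (sup (range (fun v => yhi (lay v))) - inf (range (fun v => ylo (lay v)))).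

End Geometry.

(* Main.v *)
Require Import Defs.
From mathcomp Require Import all_boot all_order all_algebra.
From mathcomp Require Import classical_sets reals.
From mathcomp Require Import zify lra.
Import Order.TTheory GRing.Theory Num.Theory.
Local Open Scope ring_scope.

(** If two rectangles are separated by a vertical strip of positive width, every
    rectangle meeting both crosses that strip, so their common neighbours are
    stacked vertically and force a large height; likewise for horizontal strips.
    If there is no such strip in either direction, the two rectangles meet in a
    (possibly degenerate) segment and every common neighbour contains one of its
    end points; as a point lies in at most four non-overlapping rectangles, there
    are at most eight common neighbours. So for [n > 8] the struts [L], [R] are
    strictly separated, say horizontally, giving height at least [n]. The struts
    of the second ladder both meet [L] and [R], hence both cross the strip and
    cannot be separated horizontally; they are separated vertically, giving width
    at least [n]. For [n <= 8] any area is at least [1 >= n ^ 2 / 64]. *)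

Set Implicit Arguments.
Unset Strict Implicit.
Unset Printing Implicit Defensive.

(** * Plane geometry of axis-parallel rectangles *)

Section Rectangles.
Variable R : realType.
Implicit Types A B C : rect R.

(** Reflection in the diagonal; it turns every vertical claim into a horizontal one. *)
Definition swap_rect A : rect R := Rect (rect_y A) (rect_x A).

Definition nonoverlap A B : bool :=
  [|| xhi A <= xlo B, xhi B <= xlo A, yhi A <= ylo B | yhi B <= ylo A].

(** Weaker than adjacency: contact at a single point is allowed. *)
Definition meets A B : bool :=
  [&& xlo A <= xhi B, xlo B <= xhi A, ylo A <= yhi B & ylo B <= yhi A].

Definition hseparated A B : bool := (xhi A < xlo B) || (xhi B < xlo A).

Definition vseparated A B : bool := (yhi A < ylo B) || (yhi B < ylo A).

Lemma nonoverlap_swap A B :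
  nonoverlap (swap_rect A) (swap_rect B) = nonoverlap A B.
Proof. by rewrite /nonoverlap /=; do 4![case: (_ <= _)]. Qed.

Lemma meets_swap A B : meets (swap_rect A) (swap_rect B) = meets A B.
Proof. by rewrite /meets /=; do 4![case: (_ <= _)]. Qed.

Lemma disjoint_interior_nonoverlap A B :
  (rect_interior A `&` rect_interior B = set0)%classic -> nonoverlap A B.
Proof.
move=> AB0; rewrite /nonoverlap; apply/negPn/negP.
rewrite !negb_or -!ltNge => /and4P[BA1 AB1 BA2 AB2].
have mid (a b c d : R) : a < b -> c < d -> c < b -> a < d ->
    exists m : R, [/\ a < m, m < b, c < m & m < d].
  move=> ab cd cb ad; exists ((Num.max a c + Num.min b d) / 2).
  by case: (leP a c) => ac; case: (leP b d) => bd; split; lra.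
have [u [u1 u2 u3 u4]] := mid _ _ _ _ (rect_x A) (rect_x B) BA1 AB1.
have [v [v1 v2 v3 v4]] := mid _ _ _ _ (rect_y A) (rect_y B) BA2 AB2.
suff : (rect_interior A `&` rect_interior B)%classic (u, v) by rewrite AB0.
by split; split; apply/andP.
Qed.

Lemma share_segment_meets A B : share_segment A B -> meets A B.
Proof.
case=> p [q [_ /(_ p)]] [|[[/andP[p1 p2] /andP[p3 p4]] _]
    [[/andP[p5 p6] /andP[p7 p8]] _]].
  (* Parameter 0 gives the end point [p] of the shared segment, which lies in both closed
     rectangles. *)
  exists 0; rewrite ?lexx ?ler01 //.
  by rewrite !mul0r !addr0; case: p.
by apply/and4P; split; lra.
Qed.

Definition contains A (p : R * R) : bool :=
  [&& xlo A <= p.1, p.1 <= xhi A, ylo A <= p.2 & p.2 <= yhi A].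

(** Names a quadrant at [p] that [A] fills near [p] when [A] contains [p]: [true] is left or below;
    otherwise [p] is on the low side and [A] extends right or above. *)
Definition quadrant A (p : R * R) : bool * bool := (xlo A < p.1, ylo A < p.2).

Lemma quadrant_overlap A B p : contains A p -> contains B p ->
  quadrant A p = quadrant B p -> ~~ nonoverlap A B.
Proof.
case: p => u v /and4P[/= a1 a2 a3 a4] /and4P[/= b1 b2 b3 b4] [].
have := (rect_x A, rect_y A, rect_x B, rect_y B) => -[[[ax ay] bx] by_].
rewrite /nonoverlap !negb_or -!ltNge /=.
by case: (ltP (xlo A) u) => ?; case: (ltP (xlo B) u) => ? //;
  case: (ltP (ylo A) v) => ?; case: (ltP (ylo B) v) => ? // _ _;
  apply/and4P; split; lra.
Qed.

Definition lower_corner A B : R * R :=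
  (Num.max (xlo A) (xlo B), Num.max (ylo A) (ylo B)).

Definition upper_corner A B : R * R :=
  (Num.min (xhi A) (xhi B), Num.min (yhi A) (yhi B)).

(** The x-range of [C] contains the common line at [xhi A]. If [C] misses both corners, its y-range
    lies strictly inside those of [A] and [B]; having positive width, [C] then overlaps one of
    them. *)
Lemma adjoining_x_corner A B C :
  xhi A <= xlo B -> ~~ hseparated A B -> nonoverlap A C -> nonoverlap B C ->
  meets A C -> meets B C ->
  contains C (lower_corner A B) || contains C (upper_corner A B).
Proof.
rewrite /hseparated negb_or -!leNgt => AB /andP[BA _] AC BC.
move=> /and4P[m1 m2 m3 m4] /and4P[k1 k2 k3 k4].
have := (rect_x A, rect_y A, rect_x B, rect_y B, rect_x C, rect_y C).
move=> [[[[[ax ay] bx] by_] cx] cy].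
have -> : lower_corner A B = (xhi A, Num.max (ylo A) (ylo B)).
  by rewrite /lower_corner max_r; [congr pair|]; lra.
have -> : upper_corner A B = (xhi A, Num.min (yhi A) (yhi B)).
  by rewrite /upper_corner min_l; [congr pair|]; lra.
rewrite /contains /=.
case: (leP (ylo C) (Num.max _ _)) => [C1|].
  apply/orP; left; rewrite m2 (le_trans AB k1) ge_max.
  by apply/and4P; split => //; apply/andP; split; lra.
rewrite gt_max => /andP[C1 C1'].
case: (leP (Num.min _ _) (yhi C)) => [C2|].
  apply/orP; right; rewrite m2 (le_trans AB k1) le_min.
  by apply/and4P; split => //; apply/andP; split; lra.
rewrite lt_min => /andP[C2 C2']; exfalso.
by case/or4P: AC => AC; case/or4P: BC => BC; lra.
Qed.

Lemma hseparatedC A B : hseparated A B = hseparated B A.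
Proof. by rewrite /hseparated orbC. Qed.

Lemma contains_swap A u v : contains (swap_rect A) (v, u) = contains A (u, v).
Proof. by rewrite /contains /=; do 4![case: (_ <= _)]. Qed.

Lemma adjoining_corner A B C :
  nonoverlap A B -> ~~ hseparated A B -> ~~ vseparated A B ->
  nonoverlap A C -> nonoverlap B C -> meets A C -> meets B C ->
  contains C (lower_corner A B) || contains C (upper_corner A B).
Proof.
move=> AB hAB vAB AC BC mAC mBC.
have cornerC (A' B' : rect R) : (lower_corner A' B' = lower_corner B' A') *
    (upper_corner A' B' = upper_corner B' A').
  by split; congr pair; rewrite (maxC, minC).
(* Exchanging [A] and [B] and reflecting in the diagonal reduce all four cases to [A] left of
   [B]. *)
case/or4P: AB => AB; [|rewrite !(cornerC A B)| |rewrite !(cornerC A B)].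
- exact: adjoining_x_corner.
- by apply: adjoining_x_corner; rewrite // hseparatedC.
- have := @adjoining_x_corner (swap_rect A) (swap_rect B) (swap_rect C).
  by rewrite !contains_swap !nonoverlap_swap !meets_swap; apply.
- have := @adjoining_x_corner (swap_rect B) (swap_rect A) (swap_rect C).
  rewrite !contains_swap !nonoverlap_swap !meets_swap; apply => //.
  by rewrite hseparatedC.
Qed.

(** Induction on the size: take out the interval [i] with the greatest lower end. All others end by
    [lo i], which becomes the new upper bound in place of [b]. *)
Lemma stacked_intervals (T : eqType) (s : seq T) (lo hi : T -> R) (a b : R) :
  a <= b -> uniq s -> {in s, forall i, [/\ a <= lo i, lo i + 1 <= hi i & hi i <= b]} ->
  {in s &, forall i j, i != j -> (hi i <= lo j) || (hi j <= lo i)} ->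
  (size s)%:R <= b - a.
Proof.
move En : (size s) => n; elim: n => [|n IHn] in s b En *; first by rewrite subr_ge0.
move=> ab Us bnd sep.
have [i si maxi] : exists2 i, i \in s & {in s, forall j, lo j <= lo i}.
  case: {+}s En => // i0 s' _; elim: s' i0 => [|j s' IHs] i0.
    by exists i0; rewrite ?mem_head // => k /[1!inE] /eqP ->.
  have [i si maxi] := IHs j.
  case: (leP (lo i0) (lo i)) => i0i.
    by exists i => [|k]; rewrite inE ?si ?orbT // => /orP[/eqP-> //|/maxi].
  exists i0 => [|k]; first by rewrite mem_head.
  by rewrite inE => /orP[/eqP-> //|/maxi/le_trans->//]; apply: ltW.
have [ai hi1 hb] := bnd i si.
have sub j : j \in rem i s -> (j != i) && (j \in s) by rewrite mem_rem_uniq // inE.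
have : n%:R <= lo i - a.
  apply: (IHn (rem i s)) => //; rewrite ?rem_uniq ?size_rem ?En //.
    move=> j /sub/andP[ji sj]; have [aj hj1 hjb] := bnd j sj.
    split => //; have /orP[//|ij] := sep j i sj si ji.
    by have := maxi j sj; lra.
  by move=> j k /sub/andP[_ sj] /sub/andP[_ sk]; apply: sep.
by rewrite -natr1; lra.
Qed.

End Rectangles.

(** * Common neighbours of two rectangles *)

Section CommonNeighbours.
Variables (R : realType) (T : finType) (lay : T -> rect R).
Hypothesis lay_nonoverlap : forall u v : T, u != v -> nonoverlap (lay u) (lay v).

Definition common_neighbours (a b : T) (s : seq T) : bool :=
  [&& uniq [:: a, b & s], all (fun v => meets (lay a) (lay v)) s &
      all (fun v => meets (lay b) (lay v)) s].

Lemma adjoining_few_common_neighbours a b s : common_neighbours a b s ->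
  ~~ hseparated (lay a) (lay b) -> ~~ vseparated (lay a) (lay b) ->
  (size s <= 8)%N.
Proof.
move=> /and3P[/= /and3P[]]; rewrite inE negb_or => /andP[ab as_] bs us.
move=> /allP ma /allP mb hab vab.
set p := lower_corner (lay a) (lay b); set q := upper_corner (lay a) (lay b).
have pq v : v \in s -> contains (lay v) p || contains (lay v) q.
  move=> sv; apply: adjoining_corner; rewrite ?ma ?mb // lay_nonoverlap //.
    by apply: contraNneq as_ => ->.
  by apply: contraNneq bs => ->.
(* Records which end point is used and the quadrant filled there: 2 * 4 = 8 values, and equal values
   would force an overlap. *)
pose corner v := (contains (lay v) p,
  quadrant (lay v) (if contains (lay v) p then p else q)).
have corner_inj : {in s &, injective corner}.
  move=> u v su sv [pE]; rewrite -pE => q1 q2.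
  apply/eqP; apply: contraT => uv; apply: contraTT (lay_nonoverlap uv) => _.
  apply: (quadrant_overlap _ _ (p := if contains (lay u) p then p else q)).
  - by have := pq u su; case: ifP.
  - by have := pq v sv; rewrite -pE; case: ifP => // up _; rewrite -pE.
  - by rewrite /quadrant q1 q2.
have /card_uniqP : uniq (map corner s) by rewrite map_inj_in_uniq.
rewrite size_map => <-; apply: leq_trans (max_card _) _.
by rewrite !card_prod card_bool.
Qed.

(** All members of [s] span the strip between [a] and [b], so no two lie side by side; their
    y-ranges, of length at least 1, are stacked. *)
Lemma hseparated_common_neighbours a b s (y0 y1 : R) :
  (forall v, [/\ y0 <= ylo (lay v), ylo (lay v) + 1 <= yhi (lay v) &
                 yhi (lay v) <= y1]) ->
  common_neighbours a b s -> hseparated (lay a) (lay b) ->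
  (size s)%:R <= y1 - y0.
Proof.
move=> bnd /and3P[/= /and3P[_ _ us] /allP ma /allP mb] hab.
apply: (@stacked_intervals _ _ s (fun v => ylo (lay v)) (fun v => yhi (lay v))) => //.
  by have [] := bnd a; lra.
move=> u v /[dup] /ma /and4P[u1 u2 _ _] /mb /and4P[u3 u4 _ _].
move=> /[dup] /ma /and4P[v1 v2 _ _] /mb /and4P[v3 v4 _ _] /lay_nonoverlap.
case/or4P => [uv|uv|->|->]; rewrite ?orbT //; exfalso.
  by case/orP: hab => ?; lra.
by case/orP: hab => ?; lra.
Qed.

Lemma crossing_not_hseparated a b c d :
  hseparated (lay a) (lay b) ->
  meets (lay a) (lay c) -> meets (lay b) (lay c) ->
  meets (lay a) (lay d) -> meets (lay b) (lay d) ->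
  ~~ hseparated (lay c) (lay d).
Proof.
move=> hab /and4P[? ? _ _] /and4P[? ? _ _] /and4P[? ? _ _] /and4P[? ? _ _].
by apply/negP => /orP[] ?; case/orP: hab => ?; lra.
Qed.

End CommonNeighbours.

(** * Two crossing families of common neighbours *)

Section CrossedLadders.
Variables (R : realType) (T : finType).

Lemma common_neighbours_swap (lay : T -> rect R) (a b : T) (s : seq T) :
  common_neighbours (fun v => swap_rect (lay v)) a b s =
  common_neighbours lay a b s.
Proof. by congr [&& _, _ & _]; apply: eq_all => v; exact: meets_swap. Qed.

Lemma crossed_common_neighbours_h (lay : T -> rect R) (a b c d : T) (s t : seq T)
    (x0 x1 y0 y1 : R) :
  (forall u v : T, u != v -> nonoverlap (lay u) (lay v)) ->
  (forall v, [/\ x0 <= xlo (lay v), xlo (lay v) + 1 <= xhi (lay v) &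
                 xhi (lay v) <= x1]) ->
  (forall v, [/\ y0 <= ylo (lay v), ylo (lay v) + 1 <= yhi (lay v) &
                 yhi (lay v) <= y1]) ->
  common_neighbours lay a b s -> common_neighbours lay c d t ->
  c \in s -> d \in s -> (8 < size t)%N -> hseparated (lay a) (lay b) ->
  (size t)%:R <= x1 - x0 /\ (size s)%:R <= y1 - y0.
Proof.
move=> lay_no xb yb nab ncd cs ds t8 hab; split; last first.
  exact: hseparated_common_neighbours nab hab.
have /and3P[_ /allP ma /allP mb] := nab.
have hcd := crossing_not_hseparated hab (ma c cs) (mb c cs) (ma d ds) (mb d ds).
have vcd : vseparated (lay c) (lay d).
  apply: contraLR t8 => vcd; rewrite -leqNgt.
  exact: adjoining_few_common_neighbours ncd hcd vcd.
apply: (@hseparated_common_neighbours _ _ (fun v => swap_rect (lay v)) _ c d) => //.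
  by move=> u v /lay_no; rewrite nonoverlap_swap.
by rewrite common_neighbours_swap.
Qed.

Lemma crossed_common_neighbours (lay : T -> rect R) (a b c d : T) (s t : seq T)
    (x0 x1 y0 y1 : R) (n : nat) :
  (forall u v : T, u != v -> nonoverlap (lay u) (lay v)) ->
  (forall v, [/\ x0 <= xlo (lay v), xlo (lay v) + 1 <= xhi (lay v) &
                 xhi (lay v) <= x1]) ->
  (forall v, [/\ y0 <= ylo (lay v), ylo (lay v) + 1 <= yhi (lay v) &
                 yhi (lay v) <= y1]) ->
  common_neighbours lay a b s -> common_neighbours lay c d t ->
  c \in s -> d \in s -> size s = n -> size t = n -> (8 < n)%N ->
  n%:R <= x1 - x0 /\ n%:R <= y1 - y0.
Proof.
move=> lay_no xb yb nab ncd cs ds sn tn n8.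
have [hab|hab] := boolP (hseparated (lay a) (lay b)).
  rewrite -{1}tn -sn.
  by apply: crossed_common_neighbours_h ncd cs ds _ hab; rewrite ?tn.
have vab : vseparated (lay a) (lay b).
  apply: contraLR n8 => vab; rewrite -leqNgt -sn.
  exact: adjoining_few_common_neighbours nab hab vab.
(* Reflection exchanges width and height, hence the two conclusions. *)
apply/and_comm; rewrite -{1}tn -sn.
apply: (@crossed_common_neighbours_h (fun v => swap_rect (lay v)) a b c d) => //.
- by move=> u v /lay_no; rewrite nonoverlap_swap.
- by rewrite common_neighbours_swap.
- by rewrite common_neighbours_swap.
- by rewrite tn.
Qed.

Lemma le_sup_fin (f : T -> R) (v : T) : f v <= sup (range f).
Proof.
apply: ub_le_sup; last by exists v.
(* Any upper bound will do here; the sum of absolute values avoids choosing a maximum. *)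
exists (\sum_u `|f u|) => _ [u _ <-].
by rewrite (bigD1 u) //= (le_trans (ler_norm _)) // lerDl sumr_ge0.
Qed.

Lemma inf_fin_le (f : T -> R) (v : T) : inf (range f) <= f v.
Proof.
apply: ge_inf; last by exists v.
exists (- \sum_u `|f u|) => _ [u _ <-]; rewrite lerNl.
by rewrite (bigD1 u) //= -normrN (le_trans (ler_norm _)) // lerDl sumr_ge0.
Qed.

End CrossedLadders.

(** * The integer grid and the area bound *)

Lemma int_ltD1 (R : realType) (a b : R) :
  a \is a Num.int -> b \is a Num.int -> a < b -> a + 1 <= b.
Proof. by move=> /intrP[m ->] /intrP[k ->]; rewrite ltr_int -(intrD _ m 1) ler_int lezD1. Qed.

Theorem theorem5 (R : realType) :
  exists c : R, 0 < c /\
    forall (n : nat), (4 <= n)%N ->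
    forall (T : finType) (e : rel T), is_ij_ladder e n n ->
    forall lay : T -> rect R,
      is_rect_layout e lay ->
      (forall v : T, on_integer_grid (lay v)) ->
      c * n%:R ^+ 2 <= layout_area lay.
Proof.
(* Here 64 is the square of the threshold 8, up to which only area at least 1 is known. *)
exists 64^-1; split; first by rewrite invr_gt0 ltr0n.
move=> n n4 T e [L [S [x [y [e1 [e2 [_ eE lad1 lad2]]]]]]] lay laye grid.
have lay_no u v : u != v -> nonoverlap (lay u) (lay v).
  by move=> /eqP/laye[/disjoint_interior_nonoverlap].
have lay_meets u v : u != v -> e u v -> meets (lay u) (lay v).
  by move=> /eqP/laye[_ [_ +]] euv => /(_ euv)/share_segment_meets.
rewrite /layout_area; set x1 := sup _; set x0 := inf _; set y1 := sup _; set y0 := inf _.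
have xb v : [/\ x0 <= xlo (lay v), xlo (lay v) + 1 <= xhi (lay v) & xhi (lay v) <= x1].
  have [? ? _ _] := grid v; split; first exact: (inf_fin_le (fun v => xlo (lay v))).
    exact: int_ltD1 (rect_x _).
  exact: (le_sup_fin (fun v => xhi (lay v))).
have yb v : [/\ y0 <= ylo (lay v), ylo (lay v) + 1 <= yhi (lay v) & yhi (lay v) <= y1].
  have [_ _ ? ?] := grid v; split; first exact: (inf_fin_le (fun v => ylo (lay v))).
    exact: int_ltD1 (rect_y _).
  exact: (le_sup_fin (fun v => yhi (lay v))).
have ladN (f : rel T) a b z : (forall u v, f u v -> e u v) ->
    is_rung_ladder f n a b z -> common_neighbours lay a b [seq z k | k <- iota 1 n].
  move=> fe [[fsym _] Uz fz _]; rewrite /common_neighbours Uz.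
  move: Uz; rewrite /= inE negb_or => /and3P[/andP[_ az] bz _].
  apply/andP; split; apply/allP => _ /mapP[k kn ->] /=;
    apply: lay_meets.
  - by apply: contraNneq az => ->; apply: map_f.
  - by apply: fe; have [|] := fz k => //; move: kn; rewrite mem_iota; lia.
  - by apply: contraNneq bz => ->; apply: map_f.
  - apply: fe; rewrite fsym.
    by have [|] := fz k => //; move: kn; rewrite mem_iota; lia.
have N1 := ladN _ _ _ _ (fun u v uv => etrans (eE u v) (introT orP (or_introl uv))) lad1.
have N2 := ladN _ _ _ _ (fun u v uv => etrans (eE u v) (introT orP (or_intror uv))) lad2.
have [n8|n8] := leqP n 8.
  have [? ? ?] := xb L; have [? ? ?] := yb L.
  have : 1 <= (x1 - x0) * (y1 - y0) by rewrite mulr_ege1 //; lra.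
  apply: le_trans; rewrite ler_pdivrMl ?ltr0n // mulr1 -natrX ler_nat.
  by rewrite (@leq_exp2r n 8 2).
have [] := crossed_common_neighbours lay_no xb yb N1 N2 (n := n).
(* The struts of the second ladder are the rungs [n./2] and [n./2.+1] of the first; both indices lie
   between 1 and [n]. *)
- by apply: map_f; rewrite mem_iota; lia.
- by apply: map_f; rewrite mem_iota; lia.
- by rewrite size_map size_iota.
- by rewrite size_map size_iota.
- by [].
move=> nx ny; have n0 : 0 <= n%:R :> R by rewrite ler0n.
apply: (@le_trans _ _ (n%:R ^+ 2)).
  by rewrite ger_pMl ?invf_le1 ?ltr0n ?ler1n // exprn_gt0 // ltr0n; lia.
by rewrite expr2 ler_pM.
Qed.
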